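(* For every monoid endomorphism $\varphi\colon\boldsymbol{B}_{\omega}\to\boldsymbol{B}_{\omega}$ of the bicyclic monoid there exists $k\in\omega$ such that $\varphi=\varepsilon_{k[0]}$, i.e. $\varphi(m,n)=(km,kn)$ for all $m,n\in\omega$.
   Context: $\omega$ is the set of non-negative integers. The bicyclic monoid is realized as $\boldsymbol{B}_{\omega}=\omega\times\omega$ with operation $(i_1,j_1)\cdot(i_2,j_2)=(i_1+i_2-\min\{j_1,i_2\},\;j_1+j_2-\min\{j_1,i_2\})$ and identity $(0,0)$. A monoid endomorphism is a multiplicative self-map that fixes the identity $(0,0)$. For $k\in\omega$, $\varepsilon_{k[0]}\colon\boldsymbol{B}_{\omega}\to\boldsymbol{B}_{\omega}$ is the map $(m,n)\mapsto(km,kn)$. *)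

(* Defs.v *)
From HB Require Import structures.
From mathcomp Require Import all_boot.
From mathcomp Require Import monoid zify.

Set Implicit Arguments.
Unset Strict Implicit.
Unset Printing Implicit Defensive.

Local Open Scope nat_scope.

(* An alias of nat * nat rather than the pair type itself, because pairs of
   monoids already carry the componentwise product. *)
Definition bicyclic : Type := nat * nat.

HB.instance Definition _ := Choice.on bicyclic.

(* The subtractions never truncate: the minimum is at most i2, resp. j1. *)
Definition bicyclic_mul (x y : bicyclic) : bicyclic :=
  let: (i1, j1) := x in let: (i2, j2) := y in
  (i1 + i2 - minn j1 i2, j1 + j2 - minn j1 i2).

Definition bicyclic_one : bicyclic := (0, 0).

Lemma bicyclic_mulA : associative bicyclic_mul.
Proof. by move=> [a b] [c d] [e f]; rewrite /bicyclic_mul; congr pair; lia. Qed.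

Lemma bicyclic_mul1r : left_id bicyclic_one bicyclic_mul.
Proof. by move=> [a b]; rewrite /bicyclic_mul /=; congr pair; lia. Qed.

Lemma bicyclic_mulr1 : right_id bicyclic_one bicyclic_mul.
Proof. by move=> [a b]; rewrite /bicyclic_mul /=; congr pair; lia. Qed.

HB.instance Definition _ :=
  isMonoid.Build bicyclic bicyclic_mulA bicyclic_mul1r bicyclic_mulr1.

Definition eps (k : nat) (x : bicyclic) : bicyclic := (k * x.1, k * x.2).

(* Main.v *)
Require Import Defs.
From HB Require Import structures.
From mathcomp Require Import all_boot monoid.
From mathcomp Require Import zify.

(** With [p = (0, 1)] and [q = (1, 0)], every element of the bicyclic monoid is
    [(m, n) = q ^ m * p ^ n], and [p * q = 1]. A relation [x * y = 1] forces
    [x = (0, k)] and [y = (k, 0)] for a common [k]; applied to the images of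
    [p] and [q], this determines the endomorphism. *)

Lemma bicyclic_mul_eq1 (x y : bicyclic) :
  bicyclic_mul x y = bicyclic_one -> exists k : nat, x = (0, k) /\ y = (k, 0).
Proof.
case: x y => [a b] [c d] [h1 h2].
(* Each coordinate is a sum of two naturals, [a + (c - minn b c)] and [d + (b - minn b c)]; both
   vanish only if [a = d = 0] and [b = c]. *)
by exists b; split; congr pair; lia.
Qed.

Theorem mainTheorem5 (phi : bicyclic -> bicyclic)
  (hphi : monoid_morphism phi) :
  exists k : nat, phi =1 eps k.
Proof.
have phi1 : phi (0, 0) = (0, 0) := hphi.1.
have phiM : {morph phi : x y / bicyclic_mul x y} := hphi.2.
have phi_pq : bicyclic_mul (phi (0, 1)) (phi (1, 0)) = bicyclic_one.
  (* The product of [(0, 1)] and [(1, 0)] computes to [(0, 0)], so [phi1] closes the goal by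
     conversion. *)
  by rewrite -phiM; exact: phi1.
have [k [phip phiq]] := bicyclic_mul_eq1 _ _ phi_pq.
exists k.
have phi_qX m : phi (m, 0) = (k * m, 0).
  elim: m => [|m IHm]; first by rewrite muln0.
  (* Nothing cancels: the minimum in this product is 0, so first coordinates simply add. *)
  have -> : (m.+1, 0) = bicyclic_mul (1, 0) (m, 0) by congr pair; lia.
  by rewrite phiM phiq IHm; congr pair; lia.
have phi_pX n : phi (0, n) = (0, k * n).
  elim: n => [|n IHn]; first by rewrite muln0.
  have -> : (0, n.+1) = bicyclic_mul (0, n) (0, 1) by congr pair; lia.
  by rewrite phiM phip IHn; congr pair; lia.
move=> [m n].
have -> : (m, n) = bicyclic_mul (m, 0) (0, n) by congr pair; lia.
by rewrite phiM phi_qX phi_pX; congr pair => /=; lia.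
Qed.
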